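(* Let $\mathcal{H}$ and $\mathcal{G}$ be real Hilbert spaces, let $L\colon\mathcal{H}\to\mathcal{G}$ be a bounded linear operator, let $B\colon\mathcal{G}\to 2^{\mathcal{G}}$ be a set-valued operator, and let $\gamma\in(0,+\infty)$. Suppose that $B+\gamma^{-1}(\mathrm{Id}_{\mathcal{G}}-L\circ L^* )$ is monotone. Then the following hold: (i) $L\overset{\gamma}{\diamond}B$ is monotone. (ii) Suppose that $\operatorname{ran}L\subset\operatorname{ran}(\mathrm{Id}_{\mathcal{G}}+\gamma B)$. Then $L\overset{\gamma}{\diamond}B$ is maximally monotone.
   Context: A set-valued operator $A\colon\mathcal{H}\to2^{\mathcal{H}}$ is monotone if $\langle x_1-x_2\mid x_1^*-x_2^*\rangle\geq 0$ whenever $x_1^*\in Ax_1$ and $x_2^*\in Ax_2$, and maximally monotone if it is monotone and its graph is not properly contained in the graph of another monotone operator. $\operatorname{ran}A=\{x^*\mid\exists x,\ x^*\in Ax\}$; $A^{-1}$ is defined by $x\in A^{-1}x^*\Leftrightarrow x^*\in Ax$. Sums, scalar multiples and compositions are pointwise, e.g. $(L^*\circ C\circ L)x=\{L^*y\mid y\in C(Lx)\}$. For a bounded linear $L\colon\mathcal{H}\to\mathcal{G}$ with adjoint $L^*$ and $C\colon\mathcal{G}\to2^{\mathcal{G}}$, the parallel composition is $L^*\triangleright C=(L^*\circ C^{-1}\circ L)^{-1}\colon\mathcal{H}\to2^{\mathcal{H}}$. For $\gamma>0$, the resolvent composition is $L\overset{\gamma}{\diamond}C=L^*\triangleright(C+\gamma^{-1}\mathrm{Id}_{\mathcal{G}})-\gamma^{-1}\mathrm{Id}_{\mathcal{H}}\colon\mathcal{H}\to2^{\mathcal{H}}$.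 *)

(* Defs.v *)
From HB Require Import structures.
From mathcomp Require Import all_boot all_order all_algebra sesquilinear.
From mathcomp Require Import all_classical all_reals all_analysis.

Set Implicit Arguments.
Unset Strict Implicit.
Unset Printing Implicit Defensive.

Import Order.TTheory GRing.Theory Num.Theory.
Import numFieldNormedType.Exports.

Local Open Scope classical_set_scope.
Local Open Scope ring_scope.

(* A real Hilbert space is a complete normed space whose norm is induced by a
   positive definite symmetric bilinear form. *)
HB.mixin Record CompleteNormedModule_isHilbert (R : realType) V
    & CompleteNormedModule R V := {
  inner : {dot V for idfun};
  norm_inner : forall x : V, `|x| = Num.sqrt (inner x x)
}.

#[short(type="hilbertType")]
HB.structure Definition Hilbert (R : realType) :=
  {V of CompleteNormedModule R V & CompleteNormedModule_isHilbert R V}.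

(* A set-valued operator from X to 2^Y is a function X -> set Y. *)

Definition single_valued (X Y : Type) (f : X -> Y) : X -> set Y :=
  fun x => [set f x].

Definition op_ran (X Y : Type) (A : X -> set Y) : set Y :=
  [set y | exists x, A x y].

Definition op_inv (X Y : Type) (A : X -> set Y) : Y -> set X :=
  fun y => [set x | A x y].

Definition op_add (X : Type) (Y : zmodType) (A C : X -> set Y) : X -> set Y :=
  fun x => [set a + c | a in A x & c in C x].

Definition op_sub (X : Type) (Y : zmodType) (A C : X -> set Y) : X -> set Y :=
  fun x => [set a - c | a in A x & c in C x].

Definition op_scale (R : pzRingType) (X : Type) (Y : lmodType R) (k : R)
    (A : X -> set Y) : X -> set Y :=
  fun x => [set k *: a | a in A x].

Section Monotone.
Context {R : realType} {H : hilbertType R}.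
Implicit Types A : H -> set H.

Definition op_monotone A : Prop :=
  forall x1 x2 u1 u2 : H, A x1 u1 -> A x2 u2 ->
    0 <= inner (x1 - x2) (u1 - u2).

Definition op_graph A : set (H * H) := [set xu | A xu.1 xu.2].

Definition op_maximally_monotone A : Prop :=
  op_monotone A /\
  forall C : H -> set H, op_monotone C -> ~ (op_graph A `<` op_graph C).

End Monotone.

Section ResolventComposition.
Context {R : realType} {H G : hilbertType R}.
Implicit Types (L : H -> G) (C : G -> set G).

(* When L is linear and bounded, such a vector exists by the Riesz
   representation theorem and is unique by definiteness of the inner product;
   the default value 0 of xget is then irrelevant. *)
Definition adjoint L : G -> H :=
  fun y => xget 0 [set z | forall x : H, inner (L x) y = inner x z].

(* The operator written L^* \triangleright C: the first argument is L, not its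
   adjoint. *)
Definition parallel_comp L C : H -> set H :=
  op_inv (fun x => [set adjoint L y | y in op_inv C (L x)]).

Definition resolvent_comp L (gamma : R) C : H -> set H :=
  op_sub
    (parallel_comp L (op_add C (op_scale gamma^-1 (single_valued idfun))))
    (op_scale gamma^-1 (single_valued idfun)).

End ResolventComposition.

(* Main.v *)
(* An element u of (L <> B) x is characterised by the existence of y such that
   x = L^* y and L (u + x / gamma) - y / gamma \in B y. Substituting this in
   <x1 - x2 | u1 - u2> gives the monotonicity form of
   B + (Id - L L^* ) / gamma on (y1, y2). Under the range condition every z is
   of the form x + gamma u: solve L z = y + gamma b with b \in B y and take
   x = L^* y. Maximality follows by the easy half of Minty's theorem.

   The adjoint exists by the Riesz representation theorem for a bounded linear
   form f, obtained by minimising J x = |x|^2 - 2 f x: if J a < inf J + e^2,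
   the discriminant of t |-> J (t h + a) - inf J gives
   |<a | h> - f h| <= e |h| for all h, so near-minimisers form a Cauchy
   sequence, whose limit represents f. *)
Require Import Defs.
From HB Require Import structures.
From mathcomp Require Import all_boot all_order all_algebra sesquilinear.
From mathcomp Require Import all_classical all_reals all_analysis.

From mathcomp Require Import ring lra.

Set Implicit Arguments.
Unset Strict Implicit.
Unset Printing Implicit Defensive.

Import Order.TTheory GRing.Theory Num.Theory.
Import numFieldNormedType.Exports.

Local Open Scope classical_set_scope.
Local Open Scope ring_scope.

Section InnerProduct.
Context {R : realType} {H : hilbertType R}.
Implicit Types x y : H.

Lemma innerC x y : inner x y = inner y x.
Proof. by rewrite hermC expr0 mul1r. Qed.

Lemma innerZl (t : R) x y : inner (t *: x) y = t * inner x y.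
Proof. exact: linearZl_LR. Qed.

Lemma innerZr (t : R) x y : inner x (t *: y) = t * inner x y.
Proof. exact: linearZr_LR. Qed.

Lemma inner_ge0 x : 0 <= inner x x.
Proof.
have [->|x0] := eqVneq x 0; first by rewrite linear0l.
exact/ltW/neq0_dnorm_gt0.
Qed.

Lemma sqr_norm x : `|x| ^+ 2 = inner x x.
Proof. by rewrite norm_inner sqr_sqrtr // inner_ge0. Qed.

Lemma norm_axpy2 (t : R) x y :
  `|t *: x + y| ^+ 2 = t ^+ 2 * `|x| ^+ 2 + t * (2 * inner x y) + `|y| ^+ 2.
Proof.
rewrite !sqr_norm linearDl !linearDr /= !innerZl !innerZr (innerC y x); ring.
Qed.

End InnerProduct.

Lemma discriminant_le0 (R : rcfType) (a b c : R) :
  (forall t, 0 <= a * t ^+ 2 + b * t + c) -> b ^+ 2 <= 4 * a * c.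
Proof.
move=> quad_ge0; pose p := Poly [:: c; b; a].
have size_p : (size p <= 3)%N by exact: size_Poly.
have := deg_le2_poly_ge0 size_p.
rewrite !coef_Poly /= subr_le0; apply=> t.
rewrite horner_Poly /= mul0r add0r mulrDl -mulrA -expr2; exact: quad_ge0.
Qed.

(** Cauchy-Schwarz, from the discriminant of the nonnegative quadratic t |-> |t x + y|^2. *)
Lemma ler_inner_norm (R : realType) (H : hilbertType R) (x y : H) :
  `|inner x y| <= `|x| * `|y|.
Proof.
rewrite -ler_sqr ?nnegrE ?mulr_ge0 // real_normK ?num_real // exprMn.
have : (2 * inner x y) ^+ 2 <= 4 * `|x| ^+ 2 * `|y| ^+ 2.
  apply: discriminant_le0 => t.
  have := sqr_ge0 (`|t *: x + y|); rewrite norm_axpy2.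
  by rewrite mulrC (mulrC t).
rewrite exprMn -mulrA -natrX ler_pM2l //.
Qed.

Section Riesz.
Context {R : realType} {H : hilbertType R} {f : H -> R} {K : R}.
Hypothesis f_scalar : scalar f.
Hypothesis f_bounded : forall x, `|f x| <= K * `|x|.

Let J (x : H) : R := `|x| ^+ 2 - 2 * f x.

(** Complete the square: |x|^2 - 2 K |x| = (|x| - K)^2 - K^2. *)
Let J_ge x : - K ^+ 2 <= J x.
Proof.
rewrite /J; have := ler_norm (f x); have := f_bounded x.
have := sqr_ge0 (`|x| - K); nra.
Qed.

Let approx_representative (e : R) :
  0 < e -> exists a, forall h, `|inner a h - f h| <= e * `|h|.
Proof.
move=> e0; have inf_J : has_inf (range J).
  split; first by exists (J 0), 0.
  by exists (- K ^+ 2) => _ [x _ <-]; exact: J_ge.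
have [_ [a _ <-] Ja] := inf_adherent (exprn_gt0 2 e0) inf_J.
exists a => h; rewrite -ler_sqr ?nnegrE ?(mulr_ge0 (ltW e0)) // real_normK ?num_real //.
have : (2 * (inner a h - f h)) ^+ 2 <= 4 * `|h| ^+ 2 * e ^+ 2.
  (* The quadratic is J (t h + a) - inf J with its constant term J a - inf J enlarged to e^2. *)
  apply: discriminant_le0 => t.
  have Jt : inf (range J) <= J (t *: h + a).
    by apply: ge_inf; [exact: inf_J.2 | exists (t *: h + a)].
  move: Jt Ja; rewrite /J norm_axpy2 f_scalar (innerC h a); lra.
rewrite !exprMn -natrX -mulrA ler_pM2l // mulrC; exact.
Qed.

Lemma riesz_representation : exists z, forall x, f x = inner x z.
Proof.
have [r r_gt0 r_lt] : exists2 r : nat -> R, forall n, 0 < r n &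
    forall e, 0 < e -> exists N, forall n, (N <= n)%N -> r n < e.
  exists (fun n => n.+1%:R^-1) => // e e0.
  by have [N _ Ne] := near_infty_natSinv_lt (PosNum e0); exists N.
have [a a_approx] := choice (fun n => approx_representative (r_gt0 n)).
(* Testing both approximations on h = a m - a n itself gives |h|^2 <= (r m + r n) |h|; then cancel
   |h|. *)
have a_dist m n : `|a m - a n| <= r m + r n.
  set h := a m - a n; have [->|h0] := eqVneq h 0.
    by rewrite normr0 addr_ge0 // ltW.
  rewrite -(@ler_pM2r _ `|h|) ?normr_gt0 // -expr2 sqr_norm {1}/h linearBl /=.
  have := ler_norm (inner (a m) h - f h).
  have := ler_norm (- (inner (a n) h - f h)); rewrite normrN.
  have := a_approx m h; have := a_approx n h; lra.
have /cvg_ex [z az] : cvg (a @ \oo).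
  apply: cauchy_cvg; apply: cauchy_exP => e e0.
  have e2 : 0 < e / 2 by rewrite divr_gt0.
  have [N Ne] := r_lt _ e2.
  exists (a N), N => // n /= Nn.
  rewrite -ball_normE /=; have := a_dist N n.
  have := Ne N (leqnn N); have := Ne n Nn => /=; lra.
exists z => x; rewrite innerC; apply/eqP.
rewrite eq_sym -subr_eq0 -normr_le0; apply/ler_addgt0Pr => e e0; rewrite add0r.
(* Both |z - a n| and r n will be below d = e / (2 (|x| + 1)), so the error is at most 2 d |x| <= e;
   the + 1 keeps d defined at x = 0. *)
have x1 : 0 < 2 * (`|x| + 1) by rewrite mulr_gt0 // ltr_wpDl.
have d0 : 0 < e / (2 * (`|x| + 1)) by rewrite divr_gt0.
have [N Ne] := r_lt _ d0.
have [M _ Me] := (cvgrPdist_lt _ _).1 az _ d0.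
pose n := maxn N M.
have {}Ne := Ne n (leq_maxl N M); have {}Me := Me n (leq_maxr N M).
rewrite /= in Ne Me.
have -> : inner z x - f x = inner (z - a n) x + (inner (a n) x - f x).
  by rewrite linearBl /=; ring.
apply: le_trans (ler_normD _ _) _.
apply: le_trans (lerD (ler_inner_norm _ _) (a_approx n x)) _.
have -> : e = e / (2 * (`|x| + 1)) * (2 * (`|x| + 1)) by rewrite divfK ?gt_eqF.
have := normr_ge0 x; nra.
Qed.

End Riesz.

Section Minty.
Context {R : realType} {H : hilbertType R}.

(** For (x, u) in a monotone extension, choose (x', u') in the graph of [A] with x' + gamma u' = x +
    gamma u. Then x - x' = - gamma (u - u'), and monotonicity gives - gamma |u - u'|^2 >= 0, so the
    two points coincide. *)
Lemma minty_maximally_monotone (gamma : R) (A : H -> set H) :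
  0 < gamma -> op_monotone A ->
  (forall z, exists x u, A x u /\ x + gamma *: u = z) ->
  op_maximally_monotone A.
Proof.
move=> gamma0 A_mono A_surj; split=> // C C_mono [AC]; apply=> -[x u] /= Cxu.
have [x' [u' [Ax'u' eq_z]]] := A_surj (x + gamma *: u).
have dx : x - x' = - gamma *: (u - u').
  apply: (addIr (gamma *: u + x')); rewrite scaleNr scalerBr opprB.
  by rewrite addrACA addNr addr0 -eq_z addrA subrK addrC.
have := C_mono _ _ _ _ Cxu (AC (x', u') Ax'u').
rewrite dx innerZl -sqr_norm mulNr oppr_ge0 pmulr_rle0 //.
rewrite exprn_even_le0 //= normr_eq0 => /eqP du.
move: dx; rewrite du scaler0 => /subr0_eq ->.
by rewrite (subr0_eq du).
Qed.

End Minty.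

Section ResolventComposition.
Context {R : realType} {H G : hilbertType R} {L : {linear H -> G}}.
Hypothesis L_bounded : bounded_near L (nbhs (0 : H)).

Lemma adjointE (x : H) (y : G) : inner (L x) y = inner x (adjoint L y).
Proof.
have [K [_ LK]] := (linear_boundedP L).1 L_bounded.
(* The bound holds for every constant strictly above [K], hence for K + 1. *)
have {}LK v : `|L v| <= (K + 1) * `|v| by apply: LK; rewrite ltrDl.
have f_scalar : scalar (fun x => inner (L x) y).
  by move=> a u v; rewrite linearP linearPl.
have f_bounded v : `|inner (L v) y| <= (K + 1) * `|y| * `|v|.
  apply: le_trans (ler_inner_norm _ _) _.
  by rewrite mulrAC ler_wpM2r // LK.
have [z zP] := riesz_representation f_scalar f_bounded.
have : [set z' | forall x', inner (L x') y = inner x' z'] (adjoint L y).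
  exact: xgetI zP.
exact.
Qed.

(** The shifted point v = u + x / gamma is what lies in the parallel composition at x: x = L^* y for
    some y with L v in B y + y / gamma. *)
Lemma resolvent_compP (gamma : R) (B : G -> set G) (x u : H) :
  resolvent_comp L gamma B x u <->
  exists2 y, x = adjoint L y & B y (L (u + gamma^-1 *: x) - gamma^-1 *: y).
Proof.
split.
- move=> [v [y [b Byb [_ [_ -> <-] Lv]] <-] [_ [_ -> <-] <-]].
  by exists y => //; rewrite subrK -Lv addrK.
- move=> [y -> By]; set x' := adjoint L y in By *.
  exists (u + gamma^-1 *: x').
    exists y => //; exists (L (u + gamma^-1 *: x') - gamma^-1 *: y) => //.
    exists (gamma^-1 *: y); last by rewrite subrK.
    by exists y.
  by exists (gamma^-1 *: x'); [exists x' | rewrite addrK].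
Qed.

End ResolventComposition.

Theorem proposition4p4 (R : realType) (H G : hilbertType R)
    (L : {linear H -> G}) (L_bounded : bounded_near L (nbhs (0 : H)))
    (B : G -> set G) (gamma : R) (gamma_gt0 : 0 < gamma)
    (B_monotone : op_monotone
      (op_add B
        (op_scale gamma^-1
          (op_sub (single_valued idfun) (single_valued (L \o adjoint L)))))) :
  op_monotone (resolvent_comp L gamma B) /\
  (range L `<=` op_ran (op_add (single_valued idfun) (op_scale gamma B)) ->
   op_maximally_monotone (resolvent_comp L gamma B)).
Proof.
have mono : op_monotone (resolvent_comp L gamma B).
  move=> x1 x2 u1 u2 /resolvent_compP[y1 x1E B1] /resolvent_compP[y2 x2E B2].
  (* Adding (y - L L^* y) / gamma to the element of B y cancels both correction terms, since x = L^*
     y, and leaves L b. *)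
  have add_graph y b x : x = adjoint L y ->
      B y (L (b + gamma^-1 *: x) - gamma^-1 *: y) ->
      op_add B (op_scale gamma^-1 (op_sub (single_valued idfun)
        (single_valued (L \o adjoint L)))) y (L b).
    move=> -> Byb; eexists; first exact: Byb.
    exists (gamma^-1 *: (y - L (adjoint L y))).
      exists (y - L (adjoint L y)) => //.
      by exists y => //; exists (L (adjoint L y)).
    by rewrite linearD linearZ /= scalerBr addrA subrK addrK.
  have := B_monotone _ _ _ _ (add_graph _ _ _ x1E B1)
    (add_graph _ _ _ x2E B2).
  (* Moving L across: <y1 - y2 | L (u1 - u2)> = <x1 - x2 | u1 - u2>. *)
  by rewrite -linearB innerC linearBr /= !adjointE // -x1E -x2E -linearBr innerC.
split=> // ran_L; apply: (minty_maximally_monotone gamma_gt0) => // z.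
have [y [_ -> [_ [b Byb <-] yb]]] := ran_L (L z) (imageT L z).
(* With u = (z - x) / gamma, u + x / gamma is z / gamma, so the required element of B y is (L z - y)
   / gamma = b. *)
exists (adjoint L y), (gamma^-1 *: z - gamma^-1 *: adjoint L y); split.
  apply/resolvent_compP; exists y => //.
  rewrite subrK linearZ /= -yb scalerDr scalerA mulVf ?gt_eqF // scale1r.
  by rewrite addrAC subrr add0r.
by rewrite scalerBr !scalerA mulfV ?gt_eqF // !scale1r addrC subrK.
Qed.
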